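(* Let $X,Y$ be real locally convex topological vector spaces, let $A\colon X\to Y$ be a continuous linear mapping, and let $g\colon Y\to(-\infty,\infty]$ be a proper convex function. Suppose that $g$ is polyhedral and that $AX\cap\mathrm{dom}(g)\neq\emptyset$. Then $$(g\circ A)^*(x^* )=\inf\{g^*(y^* )\mid y^*\in(A^* )^{-1}(x^* )\},\quad x^*\in X^*.$$ Furthermore, for any $x^*\in\mathrm{dom}((g\circ A)^* )$ there exists $y^*\in(A^* )^{-1}(x^* )$ such that $(g\circ A)^*(x^* )=g^*(y^* )$.
   Context: $A^*\colon Y^*\to X^*$ is the adjoint of $A$, $(A^* )^{-1}(x^* ):=\{y^*\in Y^*\mid A^*y^*=x^*\}$, $AX$ is the range of $A$, and $\inf\emptyset:=\infty$. For an extended-real-valued function $h$, $\mathrm{dom}(h)$ is the set of points where $h<\infty$. The Fenchel conjugate of $h\colon X\to(-\infty,\infty]$ is $h^*(x^* ):=\sup\{\langle x^*,x\rangle-h(x)\mid x\in X\}$, $x^*\in X^*$ (similarly on $Y$). A subset $P$ of a locally convex space $Z$ is a convex polyhedron if $P=\{z\in Z\mid\langle z_i^*,z\rangle\le\alpha_i,\ i=1,\dots,k\}$ for finitely many $z_i^*\in Z^*$, $\alpha_i\in\mathbb{R}$; $g$ is polyhedral if $\mathrm{epi}(g):=\{(y,\lambda)\in Y\times\mathbb{R}\mid g(y)\le\lambda\}$ is a convex polyhedron in $Y\times\mathbb{R}$. *)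

(* Defs.v *)
From HB Require Import structures.
From mathcomp Require Import all_boot all_order all_algebra.
From mathcomp Require Import all_classical all_reals ereal topology normedtype.

Set Implicit Arguments.
Unset Strict Implicit.
Unset Printing Implicit Defensive.

Import Order.TTheory GRing.Theory Num.Theory.
Import numFieldNormedType.Exports.

Local Open Scope classical_set_scope.
Local Open Scope ring_scope.
Local Open Scope ereal_scope.

(* [tvsType R] is the library's class of locally convex topological vector
   spaces over R; no separation axiom is assumed. *)

Record clinear (R : realType) (E F : tvsType R) := CLinear {
  clinear_fun :> {linear E -> F};
  clinear_continuous : continuous clinear_fun }.

Lemma clinear_eqP (R : realType) (E F : tvsType R) (f g : clinear E F) :
  f = g <-> f =1 g.
Proof.
split=> [-> //|]; case: f => [[f cf] hf]; case: g => [[g cg] hg] /= /funext fg.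
subst g; case: cf cg hf hg => [[f1] [f2]] [[g1] [g2]] hf hg.
by move: hf hg; rewrite (Prop_irrelevance f1 g1) (Prop_irrelevance f2 g2) => hf hg;
  congr CLinear; exact: Prop_irrelevance.
Qed.

Lemma clinear_comp_continuous (R : realType) (E F G : tvsType R)
  (f : clinear F G) (h : clinear E F) : continuous (f \o h).
Proof.
by move=> x; apply: continuous_comp => ?; apply: clinear_continuous.
Qed.

Definition clinear_comp (R : realType) (E F G : tvsType R)
    (f : clinear F G) (h : clinear E F) : clinear E G :=
  @CLinear R E G (f \o h) (@clinear_comp_continuous R E F G f h).

Definition dual (R : realType) (E : tvsType R) : Type := clinear E R^o.

Definition adjoint (R : realType) (X Y : tvsType R) (A : clinear X Y)
    (ystar : dual Y) : dual X :=
  clinear_comp ystar A.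

Definition edom (R : realType) (T : Type) (h : T -> \bar R) : set T :=
  [set x | h x < +oo].

Definition proper_efun (R : realType) (T : Type) (h : T -> \bar R) : Prop :=
  (forall x, h x != -oo) /\ edom h !=set0.

Definition econvex (R : realType) (E : lmodType R) (h : E -> \bar R) : Prop :=
  forall (x y : E) (t : R), (0 < t < 1)%R ->
    h (t *: x + (1 - t) *: y)%R <= t%:E * h x + (1 - t)%R%:E * h y.

Definition conjugate (R : realType) (E : tvsType R) (h : E -> \bar R)
    (xstar : dual E) : \bar R :=
  ereal_sup [set (xstar x : R)%:E - h x | x in [set: E]].

Definition convex_polyhedron (R : realType) (Z : tvsType R) (P : set Z) : Prop :=
  exists (k : nat) (zstar : 'I_k -> dual Z) (alpha : 'I_k -> R),
    P = [set z | forall i, (zstar i z <= alpha i)%R].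

(* [R^o] is R as a vector space over itself, so that [E * R^o] is again a
   locally convex space, with the product topology. *)
Definition epigraph (R : realType) (E : tvsType R) (h : E -> \bar R) :
    set (E * R^o)%type :=
  [set p | h p.1 <= (p.2 : R)%:E].

Definition polyhedral (R : realType) (E : tvsType R) (h : E -> \bar R) : Prop :=
  convex_polyhedron (epigraph h).

(* Main.v *)
Require Import Defs.
From HB Require Import structures.
From mathcomp Require Import all_boot all_order all_algebra.
From mathcomp Require Import all_classical all_reals ereal topology normedtype.
From mathcomp Require Import ring lra.
Import Order.TTheory GRing.Theory Num.Theory.
Import numFieldNormedType.Exports.

Local Open Scope classical_set_scope.
Local Open Scope ring_scope.

(** The easy inequality is [conjugate_comp_le]: conjugating [g \o A] at
    [adjoint A ystar] takes the supremum defining [conjugate g ystar] over the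
    range of [A] only.

    For the other one, let [s] be the value of the conjugate of [g \o A] at
    [xstar], assumed finite.  That [s] bounds it from above means that the
    affine inequality [xstar x - l <= s] holds for all [(x, l)] with
    [(A x, l)] in the epigraph of [g].  As [g] is polyhedral, that set is cut
    out of [X * R] by finitely many inequalities [z i (A x, l) <= alpha i],
    and it is nonempty because the range of [A] meets the domain of [g].  The
    affine Farkas lemma ([farkas_affine]) then gives multipliers [mu i >= 0]
    with
      [xstar x - l = \sum_i mu i * z i (A x, l)] for all [x] and [l],
      [\sum_i mu i * alpha i <= s].
    Put [ystar y := \sum_i mu i * z i (y, 0)].  Taking [l = 0] in the identity
    shows that the adjoint of [A] sends [ystar] to [xstar]; taking [x = 0]
    shows that [\sum_i mu i * z i (0, l) = - l], hence
    [ystar y - l = \sum_i mu i * z i (y, l) <= s] on the whole epigraph of [g],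
    that is, [conjugate g ystar <= s].  This is [polyhedral_multiplier]; with
    the easy inequality it shows that the infimum is attained and equals [s].

    The Farkas lemma is purely algebraic: it is proved by induction on the
    number of inequalities, not by separating closed convex sets, so it holds
    on infinite-dimensional spaces as well.  The form [ystar] is continuous as
    a finite combination of continuous forms. *)

Lemma scalar0 (R : pzRingType) (V : lmodType R) (f : V -> R) :
  scalar f -> f 0 = 0.
Proof. by move=> lf; have := lf (-1) 0 0; rewrite scaler0 addr0 mulN1r addNr. Qed.

Lemma scalarZ (R : pzRingType) (V : lmodType R) (f : V -> R) a v :
  scalar f -> f (a *: v) = a * f v.
Proof.
by move=> lf; have := lf a v 0; rewrite addr0 (scalar0 _ _ _ lf) addr0.
Qed.

(** Induction on the number of forms.  If the forms [f' i] other than the first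
    one, [f0], do not suffice to make [h] nonpositive, there is [v0] with
    [f' i v0 <= 0] and [0 < h v0], and then [0 < f0 v0].  Projecting along [v0] onto the kernel of [f0] turns the
    constraint [f0 <= 0] into [0 <= 0], so the induction hypothesis applies to
    the projected forms; the multiplier of [f0] is then forced by the value at
    [v0], and its sign is right because [h v0] and the [f' i v0] have opposite
    signs. *)
Lemma farkas (R : realFieldType) (V : lmodType R) (k : nat)
    (f : 'I_k -> V -> R) (h : V -> R) :
  (forall i, scalar (f i)) -> scalar h ->
  (forall v, (forall i, f i v <= 0) -> h v <= 0) ->
  exists2 mu : 'I_k -> R, forall i, 0 <= mu i &
    forall v, h v = \sum_i mu i * f i v.
Proof.
elim: k f h => [|k IH] f h lf lh fh.
  exists (fun=> 0) => // v; rewrite big_ord0; apply/eqP; rewrite eq_le.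
  rewrite fh; last by case.
  have := fh (-1 *: v) _; rewrite (scalarZ _ _ _ _ _ lh) mulN1r oppr_le0.
  by apply; case.
pose f0 := f ord0; pose f' i := f (lift ord0 i).
have lf0 : scalar f0 := lf ord0.
have lf' i : scalar (f' i) := lf (lift ord0 i).
have [fh'|] := pselect (forall v, (forall i, f' i v <= 0) -> h v <= 0).
  have [mu mu0 hE] := IH f' h lf' lh fh'.
  exists (fun i => if unlift ord0 i is Some j then mu j else 0).
    by move=> i; case: unliftP.
  move=> v; rewrite big_ord_recl unlift_none mul0r add0r hE.
  by apply: eq_bigr => i _; rewrite liftK.
move=> /existsNP[v0] /not_implyP[f'v0 /negP]; rewrite -ltNge => hv0.
have f0v0 : 0 < f0 v0.
  rewrite ltNge; apply/negP => f0v0; move: hv0; rewrite ltNge fh// => i.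
  by case: (unliftP ord0 i) => [j|] ->; [exact: f'v0|].
pose proj v := (- (f0 v / f0 v0)) *: v0 + v.
have projE (phi : V -> R) v : scalar phi ->
    phi (proj v) = phi v - phi v0 / f0 v0 * f0 v.
  by move=> lphi; rewrite lphi; ring.
have f0proj v : f0 (proj v) = 0.
  by rewrite (projE _ _ lf0) divff ?gt_eqF// mul1r subrr.
have lproj (phi : V -> R) : scalar phi -> scalar (phi \o proj).
  by move=> lphi a u v /=; rewrite !(projE _ _ lphi) lphi lf0; ring.
have [||v fv|mu mu0 hE] := IH (fun i => f' i \o proj) (h \o proj).
- by move=> i; exact/lproj/lf'.
- exact/lproj.
- apply: fh => i; case: (unliftP ord0 i) => [j|] ->; first exact: fv.
  by rewrite -/f0 f0proj.
pose m := (h v0 - \sum_i mu i * f' i v0) / f0 v0.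
exists (fun i => if unlift ord0 i is Some j then mu j else m).
  move=> i; case: unliftP => // _; apply: divr_ge0; last exact: ltW.
  rewrite subr_ge0 (le_trans _ (ltW hv0))//; apply: sumr_le0 => j _.
  exact: mulr_ge0_le0.
move=> v; rewrite big_ord_recl unlift_none.
have := hE v; rewrite /= (projE _ _ lh) => /eqP; rewrite subr_eq => /eqP ->.
under eq_bigr do rewrite (projE _ _ (lf' _)) mulrBr.
rewrite sumrB.
under [in RHS]eq_bigr do rewrite liftK.
rewrite -addrA addrC [- _ + _]addrC -/f0; congr (_ + _).
rewrite /m mulrBl mulrBl; congr (_ - _).
by rewrite 2!mulr_suml; apply: eq_bigr => i _; rewrite !mulrA.
Qed.

(** Apply the homogeneous version on [V * R] to the forms
    [f i v - alpha i * t] and [h v - beta * t], with the extra constraint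
    [0 <= t].  Points with [0 < t] rescale to [t = 1]; the multiplier of the
    extra constraint is the slack in [\sum_i mu i * alpha i <= beta]. *)
Lemma farkas_affine (R : realFieldType) (V : lmodType R) (k : nat)
    (f : 'I_k -> V -> R) (alpha : 'I_k -> R) (h : V -> R) (beta : R) :
  (forall i, scalar (f i)) -> scalar h ->
  (exists v, forall i, f i v <= alpha i) ->
  (forall v, (forall i, f i v <= alpha i) -> h v <= beta) ->
  exists mu : 'I_k -> R, [/\ forall i, 0 <= mu i,
    forall v, h v = \sum_i mu i * f i v & \sum_i mu i * alpha i <= beta].
Proof.
move=> lf lh [v1 fv1] fh.
pose F (i : 'I_k.+1) (p : V * R^o) : R :=
  if unlift ord0 i is Some j then f j p.1 - alpha j * p.2 else - p.2.
have F0 p : F ord0 p = - p.2 by rewrite /F unlift_none.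
have FS i p : F (lift ord0 i) p = f i p.1 - alpha i * p.2.
  by rewrite /F liftK.
have lhom (phi : V -> R) c : scalar phi ->
    scalar (fun p : V * R^o => phi p.1 - c * (p.2 : R)).
  by move=> lphi a [u s] [v t]; rewrite /= lphi /GRing.scale/=; lra.
have [||[v t] Fvt|mu mu0 hE] :=
    @farkas R (V * R^o)%type k.+1 F (fun p => h p.1 - beta * (p.2 : R)).
- move=> i; rewrite /F; case: (unlift ord0 i) => [j|]; first exact: lhom.
  by move=> a [u s] [v t]; rewrite /= opprD mulrN.
- exact: lhom.
- have := Fvt ord0; rewrite F0 oppr_le0 /= le_eqVlt => /orP[/eqP t0|t0].
    (* [v] is a direction of recession of the polyhedron, on which [h] is
       bounded above, so [h] cannot increase along it from [v1] *)
    have fv i : f i v <= 0.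
      by have := Fvt (lift ord0 i); rewrite FS /= -t0 mulr0 subr0.
    rewrite -t0 mulr0 subr0 leNgt; apply/negP => hv.
    have b1 : h v1 <= beta by exact: fh.
    (* [r] is chosen so that [h] takes the value [beta + 1] at [r *: v + v1] *)
    pose r := (beta - h v1 + 1) / h v.
    have r0 : 0 <= r by apply: divr_ge0; [lra|exact: ltW].
    have := fh (r *: v + v1) _; rewrite lh /r divfK ?gt_eqF// => H.
    suff : beta - h v1 + 1 + h v1 <= beta by lra.
    apply: H => i; rewrite lf; have := mulr_ge0_le0 r0 (fv i).
    by have := fv1 i; rewrite /r; lra.
  have := fh (t^-1 *: v) _; rewrite (scalarZ _ _ _ _ _ lh).
  rewrite mulrC ler_pdivrMr// subr_le0; apply => i.
  rewrite (scalarZ _ _ _ _ _ (lf i)) mulrC ler_pdivrMr// -subr_le0.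
  by have := Fvt (lift ord0 i); rewrite FS.
exists (fun i => mu (lift ord0 i)); split => // [v|].
  have := hE (v, 0); rewrite /= mulr0 subr0 big_ord_recl F0 oppr0 mulr0 add0r.
  by move=> ->; apply: eq_bigr => i _; rewrite FS /= mulr0 subr0.
have := hE (0, 1); rewrite /= (scalar0 _ _ _ lh) mulr1 sub0r big_ord_recl F0 /=.
under eq_bigr do rewrite FS /= (scalar0 _ _ _ (lf _)) sub0r mulr1 mulrN.
rewrite sumrN; have := mu0 ord0; lra.
Qed.

Local Open Scope ereal_scope.

Lemma conjugate_comp_le (R : realType) (X Y : tvsType R) (A : clinear X Y)
    (g : Y -> \bar R) (ystar : dual Y) :
  conjugate (g \o A) (adjoint A ystar) <= conjugate g ystar.
Proof.
by apply: le_ereal_sup => _ [x _ <-]; exists (A x).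
Qed.

(** Quantifying over the epigraph turns an upper bound on the conjugate into a
    system of real affine inequalities. *)
Lemma conjugate_le (R : realType) (E : tvsType R) (h : E -> \bar R)
    (xstar : dual E) (s : R) :
  (forall x, h x != -oo) ->
  conjugate h xstar <= s%:E <->
  (forall p, epigraph h p -> ((xstar p.1 : R) - p.2 <= s)%R).
Proof.
move=> hNy; split=> [hs [x l] /= hxl|hs].
  rewrite -lee_fin; apply: le_trans hs.
  apply: (@le_trans _ _ ((xstar x : R)%:E - h x)).
    by rewrite EFinB leeB.
  by apply: ereal_sup_ubound; exists x.
apply: ge_ereal_sup => _ [x _ <-].
case hx : (h x) (hNy x) => [r| |] // _; last by rewrite leNye.
by rewrite -EFinB lee_fin; apply: (hs (x, r)); rewrite /epigraph /= hx.
Qed.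

(** Provides the dual multiplier [ystar] from the forms that cut out the
    epigraph. *)
Lemma clinear_slice_sum (R : realType) (E : tvsType R) (k : nat)
    (z : 'I_k -> dual (E * R^o)%type) (mu : 'I_k -> R) :
  exists y : dual E, forall e, y e = (\sum_i mu i * (z i (e, 0) : R))%R.
Proof.
pose phi (e : E) : R^o := (\sum_i mu i * (z i (e, 0) : R))%R.
have lphi : linear phi.
  move=> a u v; rewrite /phi scaler_sumr -big_split; apply: eq_bigr => i _ /=.
  have -> : (a *: u + v, 0 : R^o)%R = (a *: (u, 0 : R^o) + (v, 0 : R^o))%R.
    by congr pair; rewrite /= scaler0 addr0.
  by rewrite linearP mulrDr /GRing.scale /= mulrCA.
have cphi : continuous phi.
  apply: continuous_big => [|i _ e]; first exact: add_continuous.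
  apply: cvgMl_tmp.
  have pair0 : {for e, continuous (fun e : E => (e, 0 : R^o)%R)}.
    apply: (@cvg_pair _ _ _ (nbhs e) (nbhs e) (nbhs (0 : R^o)%R)).
      exact: cvg_id.
    exact: cvg_cst.
  exact: continuous_comp pair0 (@clinear_continuous _ _ _ (z i) _).
pose L := GRing.isLinear.Build R E R^o *:%R phi lphi.
pose phiL : {linear E -> R^o} := HB.pack phi L.
by exists (@CLinear R E R^o phiL cphi).
Qed.

(** Strong duality: the bound [s] follows from the inequalities describing the
    epigraph of [g] pulled back by [A], so nonnegative multipliers certify it;
    the same multipliers, applied to the inequalities before the pull-back,
    define [ystar] and certify [s] for it. *)
Lemma polyhedral_multiplier (R : realType) (X Y : tvsType R) (A : clinear X Y)
    (g : Y -> \bar R) (xstar : dual X) (s : R) :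
  (forall y, g y != -oo) -> polyhedral g -> range A `&` edom g !=set0 ->
  conjugate (g \o A) xstar <= s%:E ->
  exists2 ystar : dual Y, adjoint A ystar = xstar & conjugate g ystar <= s%:E.
Proof.
move=> gNy [k [z [alpha epiE]]] [_ [[x0 _ <-] gx0]] /conjugate_le gAs.
have epiP p : epigraph g p <-> forall i, (z i p <= alpha i)%R.
  by rewrite epiE.
have [||||mu [mu0 muE mus]] := @farkas_affine R (X * R^o)%type k
    (fun i p => z i (A p.1, p.2)) alpha (fun p => (xstar p.1 : R) - p.2)%R s.
- move=> i a p q /=; rewrite linearP.
  exact: (linearP (z i) a (A p.1, p.2) (A q.1, q.2)).
- by move=> a p q /=; rewrite linearP /GRing.scale/=; lra.
- exists (x0, fine (g (A x0))) => /=; apply/epiP; rewrite /epigraph/= fineK//.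
  by rewrite fin_numE gNy lt_eqF.
- move=> p /epiP gp; apply: gAs => [x|]; [exact: gNy|exact: gp].
have [y yE] := clinear_slice_sum _ _ _ z mu.
exists y.
  apply/clinear_eqP => x; rewrite [LHS]yE.
  by have /= := muE (x, 0)%R; rewrite subr0.
apply/conjugate_le => // -[e l] /epiP el /=; apply: le_trans mus.
have -> : ((y e : R) - l = \sum_i mu i * (z i (e, l) : R))%R.
  have /= := muE (0, l)%R; rewrite !linear0 sub0r yE => ->.
  rewrite -big_split; apply: eq_bigr => i _ /=; rewrite -mulrDr; congr (_ * _)%R.
  rewrite -[LHS](linearD (z i)); congr (z i _).
  by congr pair; rewrite /= ?addr0 ?add0r.
by apply: ler_sum => i _; exact: ler_wpM2l.
Qed.

Theorem theorem6p5 (R : realType) (X Y : tvsType R) (A : clinear X Y)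
  (g : Y -> \bar R) (g_proper : proper_efun g) (g_convex : econvex g)
  (g_polyhedral : polyhedral g) (A_dom : range A `&` edom g !=set0) :
  (forall xstar : dual X,
     conjugate (g \o A) xstar =
     ereal_inf [set conjugate g ystar | ystar in adjoint A @^-1` [set xstar]])
  /\
  (forall xstar : dual X, edom (conjugate (g \o A)) xstar ->
     exists ystar : dual Y, (adjoint A @^-1` [set xstar]) ystar /\
       conjugate (g \o A) xstar = conjugate g ystar).
Proof.
have [gNy _] := g_proper.
have attained xstar : edom (conjugate (g \o A)) xstar ->
    exists ystar : dual Y, (adjoint A @^-1` [set xstar]) ystar /\
      conjugate (g \o A) xstar = conjugate g ystar.
  move=> conj_lt.
  have [_ [[x0 _ <-] gx0]] := A_dom.
  have gx0_fin : g (A x0) \is a fin_num by rewrite fin_numE gNy lt_eqF.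
  (* the term at [x0] keeps the supremum away from [-oo] *)
  have conj_fin : conjugate (g \o A) xstar \is a fin_num.
    rewrite fin_numElt conj_lt andbT.
    apply: (@lt_le_trans _ _ ((xstar x0 : R)%:E - g (A x0))).
      by rewrite -(fineK gx0_fin) -EFinB ltNyr.
    by apply: ereal_sup_ubound; exists x0.
  have [|y yx gy] := @polyhedral_multiplier _ _ _ A g xstar
    (fine (conjugate (g \o A) xstar)) gNy g_polyhedral A_dom.
    by rewrite fineK.
  exists y; split=> //; apply/eqP; rewrite eq_le -{1}yx conjugate_comp_le.
  by rewrite -(fineK conj_fin).
split=> // xstar; apply/eqP; rewrite eq_le; apply/andP; split.
  apply: le_ereal_inf_tmp => _ [y <- <-]; exact: conjugate_comp_le.
have [dom_x|] := boolP (conjugate (g \o A) xstar < +oo).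
  have [y [yx ->]] := attained _ dom_x.
  by apply: ereal_inf_lbound; exists y.
by rewrite -leNgt leye_eq => /eqP ->; exact: leey.
Qed.
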